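(* Let $r>0$, let $\Omega\subset\mathbb R^2$ be an open set containing $[-r,r]^2$, and let $\psi:\Omega\to\mathbb R$ be a continuous function with $\max_{[-r,r]^2}|\psi|<1$. Put $\delta=r/2$ and $$\mathcal Z=\Big\{z\in C^1([-\delta,\delta];\mathbb R)\ :\ z'(y)=\psi(y,z(y))\ \ \forall y\in[-\delta,\delta],\ \ z(0)\in[-\delta,\delta]\Big\}.$$ Let $\mathcal T\subset\mathcal Z$ be a local flow without penetration, i.e. a maximal (with respect to inclusion) linearly ordered subset of the partially ordered set $(\mathcal Z,\le)$. Then $(\mathcal T,d_u)$ is homeomorphic to the interval $([0,1],|\cdot|)$ by an order-preserving homeomorphism.
   Context: The order on $\mathcal Z$ is pointwise: $z_1\le z_2$ iff $z_1(t)\le z_2(t)$ for all $t\in[-\delta,\delta]$. The distance $d_u$ is the uniform distance $d_u(z_1,z_2)=\max_{y\in[-\delta,\delta]}|z_1(y)-z_2(y)|$. *)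

(* Defs.v *)
From HB Require Import structures.
From mathcomp Require Import all_boot all_order all_algebra.
From mathcomp Require Import all_classical all_reals all_analysis.

Set Implicit Arguments.
Unset Strict Implicit.
Unset Printing Implicit Defensive.

Import Order.TTheory GRing.Theory Num.Theory.
Import numFieldNormedType.Exports.

Local Open Scope classical_set_scope.
Local Open Scope ring_scope.

(* A function on A is a map whose domain is the subtype A (with the topology
   induced from R), so that equality of functions is equality on A only and
   derivatives at the endpoints of a segment are one-sided. *)
Section Derivative.
Variables (R : realType) (A : set R).
Implicit Types (z : A -> R) (y : A) (d : R).

Definition has_deriv z y d : Prop :=
  (z u - z y) / (val u - val y) @[u --> y^'] --> d.

Definition C1 z : Prop :=
  exists2 dz : A -> R, continuous dz & forall y, has_deriv z y (dz y).

Lemma C1_continuous z : C1 z -> continuous z.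
Proof.
move=> [dz _ zdz] y; apply/continuous_withinNx.
have cv : val u - val y @[u --> y^'] --> (0 : R).
  rewrite -(subrr (val y)); apply: cvgB; last exact: cvg_cst.
  apply: cvg_within_filter.
  exact: (@initial_continuous A R set_val).
have h : z y + (z u - z y) / (val u - val y) * (val u - val y) @[u --> y^']
    --> z y + dz y * 0.
  apply: cvgD; first exact: cvg_cst.
  by apply: cvgM => //; exact: zdz.
rewrite mulr0 addr0 in h.
apply: cvg_trans h; apply: near_eq_cvg.
apply: filter_app (@nbhs_dnbhs_neq _ y); apply: nearW => u uy.
rewrite divfK ?subrKC// subr_eq0.
by apply: contra uy => /eqP /val_inj ->.
Qed.

End Derivative.

Section UniformDistance.
Variables (R : realType) (X : Type).
Implicit Types z : X -> R.

(* The supremum is a maximum when z1 - z2 is continuous and X is a nonempty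
   compact space. *)
Definition d_u z1 z2 : R := sup (range (fun y => `|z1 y - z2 y|)).

End UniformDistance.

Section Flow.
Variables (R : realType) (r : R) (Omega : set (R * R)) (psi : R * R -> R).

Local Notation delta := (r / 2).

Definition time : set R := `[- delta, delta].

(* psi is a total function which is only relevant on Omega, hence the explicit
   requirement that the graph of z lies in Omega. The last clause bounds z(0),
   0 being a point of the subtype only through its value. *)
Definition is_solution (z : time -> R) : Prop :=
  [/\ C1 z,
      forall y : time,
        Omega (val y, z y) /\ has_deriv z y (psi (val y, z y)) &
      forall y : time, val y = 0 -> - delta <= z y <= delta].

Record solution : Type :=
  Solution { curve :> time -> R; curveP : `[< is_solution curve >] }.

HB.instance Definition _ := [isSub for curve].
HB.instance Definition _ := [Choice of solution by <:].
HB.instance Definition _ :=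
  [SubChoice_isSubPOrder of solution by <: with ring_display].

Lemma solution_leP (z1 z2 : solution) :
  reflect (forall t : time, z1 t <= z2 t) (z1 <= z2).
Proof. exact: lefP. Qed.

Let ubound_dist (z1 z2 : solution) :
  has_ubound (range (fun y => `|z1 y - z2 y|)).
Proof.
have sc (z : solution) : continuous z.
  by apply: C1_continuous; case: z => z /= /asboolP [].
have cd : continuous (fun y => `|z1 y - z2 y|).
  move=> y; apply: (@continuous_comp _ _ _ (fun y => z1 y - z2 y) Num.norm).
    by apply: continuousB; [exact: (sc z1 y)|exact: (sc z2 y)].
  exact: norm_continuous.
have /subspace_valL_continuousP cg := cd.
have /compact_bounded [M [_ HM]] :=
  continuous_compact cg (@segment_compact R (- delta) delta).
exists (M + 1) => _ [y _ <-].
have lM : M < M + 1 by rewrite ltrDl.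
rewrite -[leLHS]normr_id; apply: (HM _ lM).
by exists (val y); [exact: set_valP | exact: (congr1 (@^~ y) (valLK _ _))].
Qed.

Let dist_ub (z1 z2 : solution) y : `|z1 y - z2 y| <= d_u z1 z2.
Proof. by apply: ub_le_sup; [exact: ubound_dist | exists y]. Qed.

Let distxx (z : solution) : d_u z z = 0.
Proof.
rewrite /d_u; set A := (A in sup A).
have A0 : A `<=` [set 0] by move=> _ [u _ <-]; rewrite /= subrr normr0.
by have [->|->] := subset_set1 A0; rewrite ?sup0 ?sup1.
Qed.

Let dist_eq0 (z1 z2 : solution) : d_u z1 z2 = 0 -> z1 = z2.
Proof.
move=> h; apply/val_inj/funext => y; apply/eqP; rewrite -subr_eq0 -normr_le0.
by rewrite -h dist_ub.
Qed.

Let dist_sym (z1 z2 : solution) : d_u z1 z2 = d_u z2 z1.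
Proof.
rewrite /d_u (_ : (fun y => `|z1 y - z2 y|) = (fun y => `|z2 y - z1 y|))//.
by apply/funext => y; rewrite distrC.
Qed.

Let dist_triangle (z2 z1 z3 : solution) : d_u z1 z3 <= d_u z1 z2 + d_u z2 z3.
Proof.
have d_ge0 (z z' : solution) : 0 <= d_u z z'.
  rewrite /d_u; set B := (B in sup B).
  have [->|/set0P[_ [y _ _]]] := eqVneq B set0; first by rewrite sup0.
  exact: le_trans (dist_ub z z' y).
rewrite {1}/d_u; set A := (A in sup A).
have [->|/set0P A0] := eqVneq A set0; first by rewrite sup0 addr_ge0.
apply: ge_sup => // _ [y _ <-].
by rewrite (le_trans (ler_distD (z2 y) _ _))// lerD.
Qed.

HB.instance Definition _ :=
  isMetric.Build R solution distxx dist_eq0 dist_sym dist_triangle.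

(* For T : set solution, the type T thus has the topology of (T, d_u). *)
Lemma solution_mdistE (z1 z2 : solution) : mdist z1 z2 = d_u z1 z2.
Proof. by []. Qed.

Definition local_flow (T : set solution) : Prop :=
  total_on T (fun z1 z2 => z1 <= z2) /\
  forall S : set solution,
    total_on S (fun z1 z2 => z1 <= z2) -> T `<=` S -> S = T.

End Flow.

Definition unit_interval (R : realType) : set R := `[0, 1].
Arguments unit_interval R : clear implicits.

(* Main.v *)
Require Import Defs.
From HB Require Import structures.
From mathcomp Require Import all_boot all_order all_algebra.
From mathcomp Require Import all_classical all_reals all_analysis.
From mathcomp Require Import ring lra.
Import Order.TTheory GRing.Theory Num.Theory.
Import numFieldNormedType.Exports.
Local Open Scope classical_set_scope.
Local Open Scope ring_scope.

(** Solutions of [z' = psi(t, z)] form a lattice under pointwise maximum and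
    minimum: where two solutions meet, they have the same slope. Clipping a Peano
    solution through a point between the graphs of two solutions [s1 < s2] with
    them therefore gives a solution strictly between, so that a maximal chain T
    has no gaps. Since solutions are 1-Lipschitz, the integral of the difference
    of two comparable solutions controls their uniform distance, so
    s |-> \int s is an order embedding of T into R with uniformly continuous
    inverse. T is closed under uniform limits by maximality, hence its image is
    a closed bounded subset of R without gaps, that is, a segment; it is not a
    point, because through a boundary value at time 0 one always finds a second
    solution comparable with a given one.

    Peano's theorem is obtained by taking the limit of Euler step functions along
    an ultrafilter, pointwise and without equicontinuity. *)

(** * Differential equations and approximate solutions *)

Section DerivativeWithin.
Context {R : realType}.
Implicit Types (D : set R) (z g : R -> R) (f : R -> R -> R) (s t l e L : R).

(** Multiplied out, so that there is no division by [t - s] and [t = s] is harmless. Only times in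
    [D] count, which makes the derivative one-sided at an endpoint of a segment. *)
Definition deriv_within D z s l := forall eta : R, 0 < eta ->
  exists2 rho : R, 0 < rho & forall t, D t -> `|t - s| < rho ->
    `|z t - z s - l * (t - s)| <= eta * `|t - s|.

Definition ode_within D f z := forall s, D s -> deriv_within D z s (f s (z s)).

Lemma deriv_withinS D D' z s l :
  D' `<=` D -> deriv_within D z s l -> deriv_within D' z s l.
Proof.
move=> DD' h eta eta0; have [rho rho0 hrho] := h _ eta0.
by exists rho => // t /DD'; exact: hrho.
Qed.

Lemma deriv_within_continuous D z s l :
  deriv_within D z s l -> z t @[t --> within D (nbhs s)] --> z s.
Proof.
move=> /(_ 1 ltr01)[rho rho0 hrho]; apply/cvgrPdist_le => e e0.
have k0 : 0 < `|l| + 1 by rewrite ltr_wpDl.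
have m0 : 0 < Num.min rho (e / (`|l| + 1)) by rewrite lt_min rho0 divr_gt0.
rewrite near_withinE; exists (Num.min rho (e / (`|l| + 1))) => // t.
rewrite /ball_/= distrC lt_min => /andP[ht1 ht2] Dt.
have := hrho t Dt ht1; rewrite mul1r => h.
move: ht2; rewrite ltr_pdivlMr // => ht2.
rewrite distrC -[z t - z s](subrK (l * (t - s))).
rewrite (le_trans (ler_normD _ _))// normrM; nra.
Qed.

Lemma mean_value z g a b : a < b ->
    (forall u, a <= u <= b -> deriv_within `[a, b] z u (g u)) ->
  exists2 c, a < c < b & z b - z a = g c * (b - a).
Proof.
move=> ab zg.
have [||c cab ->] := @MVT R z g a b ab; last by exists c => //; rewrite in_itv in cab.
  move=> u; rewrite in_itv/= => /andP[au ub].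
  have dz := zg u _; rewrite (ltW au) (ltW ub) in dz; move/(_ isT) in dz.
  have h : h^-1 *: ((z \o shift u) (h *: 1) - z u) @[h --> 0^'] --> g u.
    apply/cvgrPdist_le => e e0; have [rho rho0 hrho] := dz _ e0.
    (* The bounds [u - a] and [b - u] keep [h + u] inside the segment. *)
    have m0 : 0 < Num.min rho (Num.min (u - a) (b - u)).
      by rewrite !lt_min rho0 !subr_gt0 au.
    apply/nbhs_ballP; exists (Num.min rho (Num.min (u - a) (b - u))) => //= h.
    rewrite /ball/= sub0r normrN !lt_min => /and3P[h1 h2 h3] h0.
    have := hrho (h + u) _; rewrite addrK => /(_ _ h1).
    rewrite -[_ *: 1]/(h * 1) mulr1.
    have -> : g u - h^-1 *: (z (h + u) - z u) =
              - ((z (h + u) - z u - g u * h) / h).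
      by rewrite -[_ *: _]/(_ * _); field.
    rewrite normrN normf_div ler_pdivrMr ?normr_gt0//; apply.
    by rewrite /= in_itv/=; move: h2 h3; rewrite !ltr_norml; lra.
  apply: DeriveDef; first by apply/cvg_ex; exists (g u).
  by apply/cvg_lim.
apply/subspace_continuousP => u; rewrite /= in_itv/= => uab.
exact: deriv_within_continuous (zg u uab).
Qed.

(* [z] solves [z' = f(t, z)] up to an error [e], in a derivative-free form that
   makes sense for step functions and passes to pointwise limits. *)
Definition approx_within D f L e z := forall m eta s t,
  `|m| <= L -> 0 <= eta <= L + 1 -> D s -> D t -> s <= t ->
  (forall u, D u -> s - e <= u <= t -> `|f u (z u) - m| <= eta) ->
  `|z t - z s - m * (t - s)| <= eta * (t - s) + e.

Lemma approx_withinW D f L e1 e2 z : e1 <= e2 ->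
  approx_within D f L e1 z -> approx_within D f L e2 z.
Proof.
move=> e12 h m eta s t mL etaL Ds Dt st hu.
apply: le_trans (h m eta s t mL etaL Ds Dt st _) _; last by rewrite lerD2l.
by move=> u Du /andP[su ut]; apply: hu => //; rewrite ut andbT; lra.
Qed.

(** By the mean value theorem the mean slope is [f c (z c)] for some [c] between [s] and [t], hence
    within [eta] of [m]. *)
Lemma ode_within_approx D f L e z : is_interval D -> 0 <= e ->
  ode_within D f z -> approx_within D f L e z.
Proof.
move=> iD e0 oz m eta s t _ /andP[eta0 _] Ds Dt; rewrite le_eqVlt => /predU1P[->|st] hu.
  by rewrite !subrr !mulr0 subrr normr0 add0r.
have Dst u : s <= u <= t -> D u by exact: iD.
have [|c /andP[sc ct] ->] := @mean_value z (fun u => f u (z u)) s t st.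
  move=> u ust; apply: (@deriv_withinS D); last exact: oz (Dst u ust).
  by move=> v; rewrite /= in_itv/=; exact: Dst.
rewrite -mulrBl normrM (ger0_norm (_ : 0 <= t - s)) ?subr_ge0 ?(ltW st)//.
rewrite -[leLHS]addr0 lerD// ler_wpM2r ?subr_ge0 ?(ltW st)//.
by apply: hu; [apply: Dst; rewrite !ltW|rewrite (ltW ct) andbT; lra].
Qed.

(** This is the case [m = 0], [eta = L], which the range [eta <= L + 1] admits. *)
Lemma approx_within_lipschitz D f L e z : 0 <= L ->
    (forall t x, `|f t x| <= L) -> approx_within D f L e z ->
  forall s t, D s -> D t -> `|z t - z s| <= L * `|t - s| + e.
Proof.
move=> L0 fL az s t Ds Dt; wlog st : s t Ds Dt / s <= t.
  move=> H; have [|/ltW ts] := leP s t; first exact: H.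
  by rewrite distrC (distrC t); exact: H.
rewrite (ger0_norm (_ : 0 <= t - s)) ?subr_ge0//.
have := az 0 L s t; rewrite normr0 mul0r subr0; apply => //.
  by rewrite L0 lerDl ler01.
by move=> u _ _; rewrite subr0.
Qed.

Definition jointly_continuous f := forall s x (e : R), 0 < e ->
  exists2 rho : R, 0 < rho & forall t y, `|t - s| < rho -> `|y - x| < rho ->
    `|f t y - f s x| <= e.

(* Approximations are only compared with [z] at the two points [s] and [t]: they
   are Lipschitz up to [e], hence near [(s, z s)] between [s] and [t], which is
   all that the continuity of [f] at [(s, z s)] needs. *)
Lemma approx_within_limit D f L z : 0 <= L ->
    (forall t x, `|f t x| <= L) -> jointly_continuous f ->
    (forall e s t, 0 < e -> D s -> D t -> exists w,
      [/\ approx_within D f L e w, `|w s - z s| <= e & `|w t - z t| <= e]) ->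
  ode_within D f z.
Proof.
move=> L0 fL fc wz s Ds eta eta0.
pose eta' := Num.min eta 1.
have eta'0 : 0 < eta' by rewrite lt_min eta0 ltr01.
have [rho1 rho10 hrho1] := fc s (z s) _ eta'0.
(* Looking back by [e' <= rho], the times [u] in play satisfy [|u - s| < 2 * rho]. There [w u] is
   within [2 * L * rho + 2 * e'] of [z s], which is below [(2 * L + 4) * rho = rho1]. *)
pose rho := rho1 / (2 * L + 4).
have k0 : 0 < 2 * L + 4 by lra.
have rho0 : 0 < rho by rewrite divr_gt0.
have rhoE : rho1 = rho * (2 * L + 4) by rewrite divfK// gt_eqF.
exists rho => // t Dt tsrho.
have -> // : `|z t - z s - f s (z s) * (t - s)| <= eta' * `|t - s| ->
    `|z t - z s - f s (z s) * (t - s)| <= eta * `|t - s|.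
  by move=> /le_trans; apply; rewrite ler_wpM2r// ge_min lexx.
apply/ler_addgt0Pr => e e0.
(* Three errors share [e]: the slack of [w], and its distances to [z] at [s] and at [t]. *)
pose e' := Num.min (e / 3) rho.
have e'0 : 0 < e' by rewrite lt_min rho0 divr_gt0.
have e'e : e' <= e / 3 by rewrite ge_min lexx.
have e'rho : e' <= rho by rewrite ge_min lexx orbT.
have [w [aw ws wt]] := wz e' s t e'0 Ds Dt.
have fw u : D u -> `|u - s| < 2 * rho -> `|f u (w u) - f s (z s)| <= eta'.
  move=> Du us; apply: hrho1; first by nra.
  have := approx_within_lipschitz _ _ _ _ _ L0 fL aw _ _ Ds Du.
  rewrite -[w u - z s](subrKA (w s)) => h.
  apply: le_lt_trans (ler_normD _ _) _; nra.
have eta'L : 0 <= eta' <= L + 1 by rewrite ltW//= ge_min lerDr L0 orbT.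
have main : `|w t - w s - f s (z s) * (t - s)| <= eta' * `|t - s| + e'.
  have [st|ts] := leP s t.
    rewrite (ger0_norm (_ : 0 <= t - s)) ?subr_ge0//; apply: aw => // u Du us.
    by apply: fw => //; move: tsrho us; rewrite !ltr_norml; lra.
  have -> : w t - w s - f s (z s) * (t - s) =
      - (w s - w t - f s (z s) * (s - t)) by ring.
  rewrite normrN (distrC t s) (gtr0_norm (_ : 0 < s - t)) ?subr_gt0//.
  apply: aw => //; first exact: ltW.
  by move=> u Du us; apply: fw => //; move: tsrho us; rewrite !ltr_norml; lra.
have -> : z t - z s - f s (z s) * (t - s) =
  (w t - w s - f s (z s) * (t - s)) + (w s - z s) - (w t - z t) by ring.
apply: le_trans (ler_normB _ _) _.
have := ler_normD (w t - w s - f s (z s) * (t - s)) (w s - z s).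
lra.
Qed.

End DerivativeWithin.

(** * Peano's theorem *)

Lemma fmap_ultra {T U : Type} (f : T -> U) (F : set_system T) :
  UltraFilter F -> UltraFilter (f @ F).
Proof.
move=> FU; have PF : ProperFilter F by exact: ultra_proper.
split; first exact: fmap_proper_filter.
move=> G PG FG; rewrite eqEsubset; split=> // A GA.
have [//|FnA] := in_ultra_setVsetC (f @^-1` A) FU.
have GnA : G (~` A) by apply: FG.
by have [? []] := filter_ex (filterI GA GnA).
Qed.

Section Peano.
Context {R : realType}.
Implicit Types (f : R -> R -> R) (s t c h e L : R).

Fixpoint euler f h c n : R :=
  if n is n'.+1 then euler f h c n' + h * f (n'%:R * h) (euler f h c n') else c.

(** Piecewise constant rather than polygonal: the jumps are absorbed by the error term of
    [approx_within]. *)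
Definition euler_step f h c t : R := euler f h c (Num.truncn (t / h)).

(** Each step adds [h] times a slope that is within [eta] of [m]; the errors add up. *)
Lemma euler_increment f h c m eta i j : 0 < h -> (i <= j)%N ->
    (forall k, (i <= k < j)%N -> `|f (k%:R * h) (euler f h c k) - m| <= eta) ->
  `|euler f h c j - euler f h c i - m * (j%:R * h - i%:R * h)| <=
    eta * (j%:R * h - i%:R * h).
Proof.
move=> h0 ij; rewrite -(subnKC ij).
elim: (j - i)%N => {ij j} [|n IHn] hk; first by rewrite addn0 !subrr !mulr0 subrr normr0.
rewrite addnS /=.
have /= fk := hk (i + n)%N; rewrite leq_addr addnS ltnSn in fk; move/(_ isT) in fk.
have {IHn}IH : `|euler f h c (i + n) - euler f h c i - m * ((i + n)%:R * h - i%:R * h)|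
    <= eta * ((i + n)%:R * h - i%:R * h).
  by apply: IHn => k /andP[ik kn]; apply: hk; rewrite ik addnS ltnS ltnW.
rewrite -(natr1 (i + n)%N); set x := euler f h c (i + n)%N in fk IH *.
set y := euler f h c i in IH *; set a := (i + n)%:R in fk IH *.
have -> : x + h * f (a * h) x - y - m * ((a + 1) * h - i%:R * h) =
  (x - y - m * (a * h - i%:R * h)) + h * (f (a * h) x - m) by ring.
rewrite (le_trans (ler_normD _ _))// normrM (gtr0_norm h0).
have : h * `|f (a * h) x - m| <= h * eta by rewrite ler_pM2l.
by lra.
Qed.

(** Rounding [s] and [t] down to the grid changes [t - s] by at most [h]. This costs [L * h] through
    [m] and [(L + 1) * h] through [eta], whence the factor [2 * L + 1]. *)
Lemma euler_step_approx f h c e L : 0 < h -> 0 <= L -> (2 * L + 1) * h <= e ->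
  approx_within [set t | 0 <= t] f L e (euler_step f h c).
Proof.
move=> h0 L0 he m eta s t mL /andP[eta0 etaL] /= s0 t0 st hu.
have trunc x : 0 <= x ->
    (Num.truncn (x / h))%:R * h <= x < (Num.truncn (x / h))%:R * h + h.
  move=> x0; have /andP[xl xu] := truncn_itv (divr_ge0 x0 (ltW h0)).
  rewrite ler_pdivlMr// in xl; rewrite ltr_pdivrMr// -natr1 mulrDl mul1r in xu.
  by rewrite xl.
have /andP[si si'] := trunc s s0; have /andP[tj tj'] := trunc t t0.
have ij : (Num.truncn (s / h) <= Num.truncn (t / h))%N.
  by apply: le_truncn; rewrite ler_pM2r ?invr_gt0.
rewrite /euler_step; set i := Num.truncn _ in si si' ij *.
set j := Num.truncn _ in tj tj' ij *.
have := @euler_increment f h c m eta i j h0 ij.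
set x := euler _ _ _ _ ; set y := euler _ _ _ _ => H.
have {}H : `|x - y - m * (j%:R * h - i%:R * h)| <= eta * (j%:R * h - i%:R * h).
  (* The first node [i * h] may precede [s] by up to [h <= e]; this explains the backward margin in
     [approx_within]. *)
  apply: H => k /andP[ik kj].
  have ikR : i%:R * h <= k%:R * h by rewrite ler_pM2r// ler_nat.
  have kjR : (k%:R + 1) * h <= j%:R * h by rewrite natr1 ler_pM2r// ler_nat.
  have -> : euler f h c k = euler_step f h c (k%:R * h).
    by rewrite /euler_step mulfK ?gt_eqF// natrK.
  have Lh : 0 <= L * h by rewrite mulr_ge0// ltW.
  apply: hu; first by rewrite mulr_ge0// ltW.
  by apply/andP; split; lra.
have -> : x - y - m * (t - s) =
  (x - y - m * (j%:R * h - i%:R * h)) + m * ((j%:R * h - i%:R * h) - (t - s)) by ring.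
rewrite (le_trans (ler_normD _ _))//.
set d := j%:R * h - i%:R * h in H *.
have dh : `|d - (t - s)| <= h by rewrite ler_norml; apply/andP; split; rewrite /d; lra.
have : `|m * (d - (t - s))| <= L * h by rewrite normrM ler_pM.
have : eta * d <= eta * (t - s) + eta * h.
  by rewrite -mulrDr ler_wpM2l// /d; lra.
have : eta * h <= (L + 1) * h by rewrite ler_pM2r.
lra.
Qed.

Lemma peano_forward f L c : 0 <= L ->
    (forall t x, `|f t x| <= L) -> jointly_continuous f ->
  exists2 w : R -> R, w 0 = c & ode_within [set t | 0 <= t] f w.
Proof.
move=> L0 fL fc.
have k0 : 0 < 2 * L + 1 by lra.
pose h n : R := n.+1%:R^-1 / (2 * L + 1).
have h0 n : 0 < h n by rewrite divr_gt0// invr_gt0 ltr0n.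
pose w n := euler_step f (h n) c.
have aw n : approx_within [set t | 0 <= t] f L n.+1%:R^-1 (w n).
  by apply: euler_step_approx => //; rewrite mulrC divfK// gt_eqF.
have w0 n : w n 0 = c by rewrite /w /euler_step mul0r truncn0.
(* Along an ultrafilter every bounded sequence converges, so the [w n t] converge for all [t] at
   once, without extracting subsequences. *)
have [U [UU leU]] := @ultraFilterLemma _ _ (@eventually_filter).
have PU : ProperFilter U by exact: ultra_proper.
have [S hS] : exists S : R -> R, forall t, 0 <= t -> w n t @[n --> U] --> S t.
  suff H : forall t, exists x : R, 0 <= t -> w n t @[n --> U] --> x.
    by have [S hS] := choice H; exists S.
  (* For [t < 0] the value is an arbitrary default. *)
  move=> t; have [t0|_] := leP 0 t; last by exists 0.
  have := @segment_compact R (c - (L * t + 1)) (c + (L * t + 1)).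
  rewrite compact_ultra => /(_ (w n t @[n --> U]))[||x [_ /= hx]]; last by exists x.
    exact: fmap_ultra.
  apply: (@filterE _ U) => n; rewrite /= in_itv/= -ler_distl.
  have := approx_within_lipschitz _ _ _ _ _ L0 fL (aw n) 0 t (lexx _) t0.
  rewrite w0 subr0 (ger0_norm t0) => /le_trans; apply.
  by rewrite lerD2l invf_le1 ?ltr0n// ler1n.
exists S.
  have h1 : w n 0 @[n --> U] --> c.
    by rewrite (_ : (fun n => w n 0) = cst c); [exact: cvg_cst|exact/funext].
  by apply: (cvg_unique _ (hS 0 (lexx _)) h1).
apply: (@approx_within_limit _ _ _ L) => // e s t e0 /= s0 t0.
have /cvgrPdist_le/(_ _ e0) hs := hS s s0.
have /cvgrPdist_le/(_ _ e0) ht := hS t t0.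
have hn : \forall n \near U, n.+1%:R^-1 <= e.
  apply: leU; have /cvgrPdist_le/(_ _ e0) := @cvg_harmonic R.
  apply: filterS => n; rewrite sub0r normrN; apply: le_trans; exact: ler_norm.
have [n [[hsn htn] hnn]] := filter_ex (filterI (filterI hs ht) hn).
exists (w n); split; [exact: approx_withinW (aw n)|by rewrite distrC|by rewrite distrC].
Qed.

(** Two forward solutions are glued at [t0]: one for the shifted field [f (t0 + t)], one for the
    time-reversed field [- f (t0 - t)]. *)
Lemma peano f L t0 c : 0 <= L ->
    (forall t x, `|f t x| <= L) -> jointly_continuous f ->
  exists2 w : R -> R, w t0 = c & ode_within setT f w.
Proof.
move=> L0 fL fc.
have [|s x e e0|wp wp0 owp] := @peano_forward (fun t x => f (t0 + t) x) L c L0.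
- by move=> t x; exact: fL.
- have [rho rho0 hrho] := fc (t0 + s) x e e0.
  by exists rho => // t y ts yx; apply: hrho => //; rewrite opprD addrACA subrr add0r.
have [|s x e e0|wm wm0 owm] := @peano_forward (fun t x => - f (t0 - t) x) L c L0.
- by move=> t x; rewrite normrN; exact: fL.
- have [rho rho0 hrho] := fc (t0 - s) x e e0.
  exists rho => // t y ts yx; rewrite -opprD normrN; apply: hrho => //.
  by rewrite (_ : _ - _ = - (t - s)) ?normrN//; ring.
pose w t := if t0 <= t then wp (t - t0) else wm (t0 - t).
have wr t : t0 <= t -> w t = wp (t - t0) by rewrite /w => ->.
have wl t : t <= t0 -> w t = wm (t0 - t).
  rewrite /w le_eqVlt => /predU1P[->|]; first by rewrite lexx subrr wp0 wm0.
  by rewrite ltNge => /negbTE ->.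
have right s : t0 <= s -> deriv_within [set t | t0 <= t] w s (f s (w s)).
  move=> ts eta eta0; have [|rho rho0 hrho] := owp (s - t0) _ _ eta0.
    by rewrite /= subr_ge0.
  exists rho => // t /= tt d; rewrite !wr//.
  have := hrho (t - t0); rewrite /= subr_ge0 subrKC.
  by rewrite (_ : t - t0 - (s - t0) = t - s); [exact|ring].
have left s : s <= t0 -> deriv_within [set t | t <= t0] w s (f s (w s)).
  move=> ts eta eta0; have [|rho rho0 hrho] := owm (t0 - s) _ _ eta0.
    by rewrite /= subr_ge0.
  exists rho => // t /= tt d; rewrite !wl//.
  have := hrho (t0 - t); rewrite /= subr_ge0 subKr (_ : t0 - t - (t0 - s) = - (t - s)); last by ring.
    by rewrite mulrNN normrN; exact.
exists w; first by rewrite wr// subrr.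
move=> s _ eta eta0.
(* Off [t0] the radius is cut down to stay on one side of [t0]; at [t0] the two one-sided estimates
   are combined. *)
have [st|ts|->] := ltgtP s t0.
- have [rho rho0 hrho] := left s (ltW st) _ eta0.
  exists (Num.min rho (t0 - s)); first by rewrite lt_min rho0 subr_gt0.
  move=> t _; rewrite lt_min => /andP[d1 d2]; apply: hrho => //=.
  by move: d2; rewrite ltr_norml; lra.
- have [rho rho0 hrho] := right s (ltW ts) _ eta0.
  exists (Num.min rho (s - t0)); first by rewrite lt_min rho0 subr_gt0.
  move=> t _; rewrite lt_min => /andP[d1 d2]; apply: hrho => //=.
  by move: d2; rewrite ltr_norml; lra.
- have [rho rho0 hrho] := right t0 (lexx _) _ eta0.
  have [rho' rho'0 hrho'] := left t0 (lexx _) _ eta0.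
  exists (Num.min rho rho'); first by rewrite lt_min rho0.
  move=> t _; rewrite lt_min => /andP[d1 d2].
  by have [tt|/ltW tt] := leP t0 t; [exact: hrho|exact: hrho'].
Qed.

End Peano.

(** * Maximum and minimum of solutions *)

Section OdeLattice.
Context {R : realType}.
Implicit Types (D : set R) (z : R -> R) (f : R -> R -> R) (s t l : R).

Lemma deriv_withinN D z s l :
  deriv_within D z s l -> deriv_within D (\- z) s (- l).
Proof.
move=> dz eta eta0; have [rho rho0 hrho] := dz _ eta0.
exists rho => // t Dt ts; have -> : (\- z) t - (\- z) s - - l * (t - s) =
  - (z t - z s - l * (t - s)) by rewrite /=; ring.
by rewrite normrN; exact: hrho.
Qed.

(** This reflection reduces minima of solutions to maxima. *)
Lemma ode_withinN D f z :
  ode_within D f z -> ode_within D (fun t x => - f t (- x)) (\- z).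
Proof. by move=> oz s Ds /=; rewrite opprK; exact/deriv_withinN/oz. Qed.

Lemma deriv_within_lt D z1 z2 s l1 l2 :
    deriv_within D z1 s l1 -> deriv_within D z2 s l2 -> z1 s < z2 s ->
  exists2 rho : R, 0 < rho & forall t, D t -> `|t - s| < rho -> z1 t < z2 t.
Proof.
move=> /deriv_within_continuous c1 /deriv_within_continuous c2 lt12.
have e0 : 0 < (z2 s - z1 s) / 2 by rewrite divr_gt0// subr_gt0.
move/cvgrPdist_lt : c1 => /(_ _ e0); rewrite near_withinE => -[rho1 /= rho10 h1].
move/cvgrPdist_lt : c2 => /(_ _ e0); rewrite near_withinE => -[rho2 /= rho20 h2].
exists (Num.min rho1 rho2); first by rewrite lt_min rho10.
move=> t Dt; rewrite lt_min => /andP[ts1 ts2].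
have := h1 t; rewrite /ball_/= distrC => /(_ ts1 Dt).
have := h2 t; rewrite /ball_/= distrC => /(_ ts2 Dt).
by rewrite !ltr_norml; lra.
Qed.

(** Where the values differ, the maximum is locally one of the solutions. Where they agree, both
    have the same slope, so the estimate holds whichever is larger at [t]. *)
Lemma ode_within_max D f z1 z2 : ode_within D f z1 -> ode_within D f z2 ->
  ode_within D f (fun t => Num.max (z1 t) (z2 t)).
Proof.
move=> oz1 oz2 s Ds; wlog : z1 z2 oz1 oz2 / z1 s <= z2 s => [H|].
  have [|le21] := orP (le_total (z1 s) (z2 s)); first exact: H.
  have -> : (fun t => Num.max (z1 t) (z2 t)) = (fun t => Num.max (z2 t) (z1 t)).
    by apply/funext => t; exact: maxC.
  by rewrite (maxC (z1 s)); exact: H.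
rewrite le_eqVlt => /predU1P[eq12|lt12] eta eta0; last first.
  have [rho rho0 lt_near] := deriv_within_lt _ _ _ _ _ _ (oz1 s Ds) (oz2 s Ds) lt12.
  have [rho2 rho20 h2] := oz2 s Ds _ eta0.
  exists (Num.min rho rho2); first by rewrite lt_min rho0.
  move=> t Dt; rewrite lt_min => /andP[ts ts2].
  by rewrite !max_r ?(ltW lt12) ?(ltW (lt_near t _ _))//; exact: h2.
have [rho1 rho10 h1] := oz1 s Ds _ eta0; have [rho2 rho20 h2] := oz2 s Ds _ eta0.
exists (Num.min rho1 rho2); first by rewrite lt_min rho10.
move=> t Dt; rewrite lt_min => /andP[ts1 ts2]; rewrite eq12 maxxx.
by case: (leP (z1 t) (z2 t)) => _; [exact: h2|rewrite -eq12; exact: h1].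
Qed.

Lemma ode_within_min D f z1 z2 : ode_within D f z1 -> ode_within D f z2 ->
  ode_within D f (fun t => Num.min (z1 t) (z2 t)).
Proof.
move=> /ode_withinN oz1 /ode_withinN oz2.
have := ode_withinN _ _ _ (ode_within_max _ _ _ _ oz1 oz2).
congr (ode_within D _ _); apply/funext => t; first apply/funext => x.
  by rewrite !opprK.
by rewrite /= oppr_max !opprK.
Qed.

End OdeLattice.

(** * Integrals of Lipschitz functions over a segment *)

Section Integral.
Context {R : realType}.
Variables (a b : R).
Hypothesis ab : a < b.
Implicit Types (z g : R -> R) (d K e : R).

Local Notation integral z := (\int[lebesgue_measure]_(t in `[a, b]) z t).

Lemma continuous_segment_integrable z : {within `[a, b], continuous z} ->
  lebesgue_measure.-integrable `[a, b] (EFin \o z).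
Proof. by apply: continuous_compact_integrable; exact: segment_compact. Qed.

Lemma Rintegral_segment_cst c d e : c <= d ->
  \int[lebesgue_measure]_(t in `[c, d]) e = e * (d - c) :> R.
Proof.
move=> cd; rewrite Rintegral_cst//= lebesgue_measure_itv/= lte_fin.
by move: cd; rewrite le_eqVlt => /predU1P[->|cd]; rewrite ?ltxx ?subrr// cd.
Qed.

Lemma Rintegral_dist_le z1 z2 e :
    {within `[a, b], continuous z1} -> {within `[a, b], continuous z2} ->
    (forall t, a <= t <= b -> `|z1 t - z2 t| <= e) ->
  `|integral z1 - integral z2| <= e * (b - a).
Proof.
move=> /continuous_segment_integrable i1 /continuous_segment_integrable i2 le_e.
have iB : lebesgue_measure.-integrable `[a, b] (EFin \o (z1 \- z2)).
  exact: (integrableB _ i1 i2).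
rewrite -RintegralB// (le_trans (le_normr_Rintegral _ iB))//.
rewrite -(Rintegral_segment_cst a b e (ltW ab)); apply: le_Rintegral => //.
- exact: integrable_norm iB.
- by apply/continuous_segment_integrable/continuous_subspaceT => t; exact: cvg_cst.
Qed.

(** A [K]-Lipschitz function reaching [d] at [t0] stays above [d / 2] up to distance [d / (2 * K)],
    so its integral dominates that of a block of height [d / 2]. *)
Lemma Rintegral_ge_peak g d K t0 : 0 < d -> 0 < K -> a <= t0 <= b ->
    {within `[a, b], continuous g} -> (forall t, a <= t <= b -> 0 <= g t) ->
    (forall t, a <= t <= b -> `|g t - g t0| <= K * `|t - t0|) ->
    d <= g t0 ->
  d / 2 * Num.min ((b - a) / 2) (d / (2 * K)) <= integral g.
Proof.
move=> d0 K0 t0ab cg g0 lipg dg; set rho := Num.min _ _.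
have rho0 : 0 < rho.
  by rewrite lt_min !divr_gt0// ?subr_gt0// mulr_gt0.
have Krho : K * rho <= d / 2.
  have : rho <= d / (2 * K) by rewrite ge_min lexx orbT.
  by rewrite ler_pdivlMr ?mulr_gt0//; lra.
have rhoab : rho <= (b - a) / 2 by rewrite ge_min lexx.
(* The block is placed on the side of [t0] facing the farther endpoint, where at least half of the
   segment is available. *)
have [c [ac cb ct]] : exists c, [/\ a <= c, c + rho <= b &
    forall t, c <= t <= c + rho -> `|t - t0| <= rho].
  have [tm|tm] := leP t0 ((a + b) / 2); [exists t0|exists (t0 - rho)];
    by split; [lra|lra|move=> t ht; rewrite ler_norml; lra].
have sub : `[c, c + rho] `<=` `[a, b].
  by move=> t; rewrite /= !in_itv/=; lra.
have ig := continuous_segment_integrable _ cg.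
rewrite -(setDUK sub) Rintegral_setU//; [|exact: measurableD|
  by rewrite setDUK|by rewrite disj_set2E setDIK].
have rest : 0 <= \int[lebesgue_measure]_(t in `[a, b] `\` `[c, c + rho]) g t.
  by apply: Rintegral_ge0 => t [/= + _]; rewrite in_itv/=; exact: g0.
apply: (@le_trans _ _ (\int[lebesgue_measure]_(t in `[c, c + rho]) g t)); last by rewrite lerDl.
have -> : d / 2 * rho = \int[lebesgue_measure]_(t in `[c, c + rho]) (d / 2).
  by rewrite Rintegral_segment_cst ?lerDl ?(ltW rho0)// addrC addKr.
apply: le_Rintegral => //.
- apply: continuous_compact_integrable; first exact: segment_compact.
  by apply: continuous_subspaceT => t; exact: cvg_cst.
- exact: integrableS ig.
- move=> t; rewrite /= in_itv/= => tc.
  have tab : a <= t <= b by lra.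
  have := lipg t tab; have := ct t tc => ht.
  have : K * `|t - t0| <= K * rho by rewrite ler_pM2l.
  by rewrite ler_norml; lra.
Qed.

End Integral.

(** * Auxiliary facts on subtypes and on closed subsets of the line *)

Lemma continuous_subset_ball {R : realType} {X Y : pseudoMetricType R}
    (A : set X) (B : set Y) (f : A -> B) :
    (forall x (e : R), 0 < e -> exists2 rho : R, 0 < rho &
      forall x', ball (val x) rho (val x') -> ball (val (f x)) e (val (f x'))) ->
  continuous f.
Proof.
move=> fc x V /nbhs_ballP[e /= e0 eV]; have [rho rho0 hrho] := fc x e e0.
apply/nbhs_ballP; exists rho => // x' xx'; apply: eV.
exact: hrho.
Qed.

Lemma ode_within_eq {R : realType} (D : set R) (f : R -> R -> R) (w w' : R -> R) :
  (forall t, D t -> w t = w' t) -> ode_within D f w -> ode_within D f w'.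
Proof.
move=> ww' ow s Ds eta eta0; have [rho rho0 hrho] := ow s Ds eta eta0.
by exists rho => // t Dt ts; rewrite -!ww'//; exact: hrho.
Qed.

(** If [x] were missing, the last point of [K] below it and the first one above it would lie in [K]
    by closedness and be distinct, and a point of [K] between them would contradict their choice. *)
Lemma closed_dense_interval {R : realType} (K : set R) :
    K !=set0 -> has_ubound K -> has_lbound K -> closed K ->
    (forall a b, K a -> K b -> a < b -> exists2 c, K c & a < c < b) ->
  [/\ K (inf K), K (sup K) & forall x, inf K <= x <= sup K -> K x].
Proof.
move=> K0 ubK lbK clK dK.
have supK (A : set R) : A !=set0 -> has_ubound A -> A `<=` K -> K (sup A).
  by move=> A0 ubA AK; apply/clK/(closureS AK); exact: closure_sup.
have infK (A : set R) : A !=set0 -> has_lbound A -> A `<=` K -> K (inf A).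
  move=> A0 lbA AK; apply: clK => B /nbhs_ballP[e /= e0 eB].
  have [a Aa ae] := inf_adherent e0 (conj A0 lbA).
  exists a; split; [exact: AK|apply: eB; rewrite /ball/= distrC ger0_norm].
    by rewrite ltrBlDl.
  by rewrite subr_ge0; exact: ge_inf.
split; [exact: infK|exact: supK|move=> x /andP[ix xs]].
apply: contrapT => NKx.
have ubA : has_ubound (K `&` [set y | y <= x]) by exists x => y [].
have lbB : has_lbound (K `&` [set y | x <= y]) by exists x => y [].
have neA : (K `&` [set y | y <= x]) !=set0 by exists (inf K); split=> //; exact: infK.
have neB : (K `&` [set y | x <= y]) !=set0 by exists (sup K); split=> //; exact: supK.
have Ka := supK _ neA ubA (@subIsetl _ _ _).
have Kb := infK _ neB lbB (@subIsetl _ _ _).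
have ax : sup (K `&` [set y | y <= x]) <= x by apply: ge_sup => // y [].
have xb : x <= inf (K `&` [set y | x <= y]) by apply: lb_le_inf => // y [].
have [|c Kc /andP[ac cb]] := dK _ _ Ka Kb.
  rewrite lt_neqAle (le_trans ax xb) andbT; apply/eqP => ab.
  by apply: NKx; rewrite (_ : x = sup (K `&` [set y | y <= x]))//; apply/le_anti; rewrite {1}ab xb ax.
have [cx|/ltW xc] := leP c x.
  by move: ac; rewrite ltNge => /negP; apply; apply: ub_le_sup.
by move: cb; rewrite ltNge => /negP; apply; apply: ge_inf.
Qed.

(** * Solutions in the square *)

(** Bridge from difference quotients on the subtype to functions on the whole line; [w] may be any
    extension of [z]. *)
Lemma has_derivP {R : realType} {A : set R} (z : A -> R) (w : R -> R) (y : A) d :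
    (forall u, z u = w (val u)) ->
  has_deriv z y d <-> deriv_within A w (val y) d.
Proof.
move=> zw; split.
  move=> /cvgrPdist_le zd eta eta0; have /nbhs_ballP[rho rho0 hrho] := zd _ eta0.
  exists rho => // t At ty.
  have [->|tNy] := eqVneq t (val y); first by rewrite !subrr mulr0 subr0 normr0 mulr0.
  have tA : t \in A by rewrite inE.
  have /= := hrho (Sub t tA); rewrite !zw !SubK.
  have dty0 : t - val y != 0 by rewrite subr_eq0.
  have -> : d - (w t - w (val y)) / (t - val y) =
      - ((w t - w (val y) - d * (t - val y)) / (t - val y)) by field.
  rewrite normrN normf_div ler_pdivrMr ?normr_gt0//; apply.
    by change (`|val y - t| < rho); rewrite distrC.
  by apply: contra tNy => /eqP <-; rewrite SubK.
move=> wd; apply/cvgrPdist_le => eta eta0; have [rho rho0 hrho] := wd _ eta0.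
apply/nbhs_ballP; exists rho => // u uy uNy.
have dty0 : val u - val y != 0.
  by rewrite subr_eq0; apply: contra uNy => /eqP /val_inj ->.
rewrite !zw.
have -> : d - (w (val u) - w (val y)) / (val u - val y) =
    - ((w (val u) - w (val y) - d * (val u - val y)) / (val u - val y)) by field.
rewrite normrN normf_div ler_pdivrMr ?normr_gt0//; apply: hrho; first exact: set_valP.
by rewrite distrC; exact: uy.
Qed.

Section Field.
Context {R : realType}.
Variables (r : R) (Omega : set (R * R)) (psi : R * R -> R).
Hypothesis r_gt0 : 0 < r.
Hypothesis openOmega : open Omega.
Hypothesis square_sub : `[- r, r] `*` `[- r, r] `<=` Omega.
Hypothesis psi_cont : {within Omega, continuous psi}.
Hypothesis psi_lt1 : sup [set `|psi p| | p in `[- r, r] `*` `[- r, r]] < 1.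

Local Notation delta := (r / 2).
Local Notation L := (sup [set `|psi p| | p in `[- r, r] `*` `[- r, r]]).

Let delta_gt0 : 0 < delta. Proof. by rewrite divr_gt0. Qed.

Definition clamp (x : R) : R := Num.max (- r) (Num.min r x).

Lemma clamp_id x : `|x| <= r -> clamp x = x.
Proof. by rewrite ler_norml /clamp => /andP[rx xr]; rewrite min_r// max_r. Qed.

Lemma clamp_norm_le x : `|clamp x| <= r.
Proof.
rewrite ler_norml /clamp le_max lexx ge_max ge_min lexx !andbT/=.
by have := r_gt0; lra.
Qed.

Lemma clamp_dist_le x y : `|clamp x - clamp y| <= `|x - y|.
Proof.
have abs_ge (a b : R) : (a - b <= `|a - b|) && (b - a <= `|a - b|).
  by rewrite ler_norm distrC ler_norm.
have max_le (a b : R) : `|Num.max (- r) a - Num.max (- r) b| <= `|a - b|.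
  have /andP[] := abs_ge a b; rewrite ler_norml.
  by case: (leP (- r) a) => ?; case: (leP (- r) b) => ? ? ?; lra.
apply: le_trans (max_le _ _) _; have /andP[] := abs_ge x y; rewrite ler_norml.
by case: (leP r x) => ?; case: (leP r y) => ? ? ?; lra.
Qed.

(** A bounded, jointly continuous extension of [psi] from the square to the plane, to which [peano]
    applies. *)
Definition field t x : R := psi (clamp t, clamp x).

Lemma field_id t x : `|t| <= r -> `|x| <= r -> field t x = psi (t, x).
Proof. by move=> tr xr; rewrite /field !clamp_id. Qed.

Let square_clamp t x : (`[- r, r] `*` `[- r, r])%classic (clamp t, clamp x).
Proof. by split; rewrite /= in_itv/= -ler_norml clamp_norm_le. Qed.

(** Compactness of the square makes the set of values bounded, so that its [sup] really is an upper
    bound. *)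
Lemma field_norm_le t x : `|field t x| <= L.
Proof.
apply: ub_le_sup; last by exists (clamp t, clamp x).
have sq : compact (`[- r, r] `*` `[- r, r])%classic.
  by apply: compact_setX; exact: segment_compact.
have cpsi := continuous_subspaceW square_sub psi_cont.
have /compact_bounded[M [_ HM]] := continuous_compact cpsi sq.
exists (M + 1) => _ [p sqp <-]; apply: (HM (M + 1)); last by exists p.
by rewrite ltrDl.
Qed.

Lemma field_bound_ge0 : 0 <= L.
Proof. exact: le_trans (normr_ge0 _) (field_norm_le 0 0). Qed.

(** Openness of [Omega] turns continuity within [Omega] into continuity at the points of the square,
    and clamping is 1-Lipschitz. *)
Lemma field_continuous : jointly_continuous field.
Proof.
move=> s x e e0.
have /cvgrPdist_le/(_ _ e0)/nbhs_ballP[rho rho0 hrho] : {for (clamp s, clamp x), continuous psi}.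
  move: psi_cont; rewrite continuous_open_subspace//; apply.
  by rewrite inE; exact/square_sub/square_clamp.
exists rho => // t y ts yx; rewrite distrC; apply: (hrho (_, _)).
by split; rewrite /ball/= distrC; exact: le_lt_trans (clamp_dist_le _ _) _.
Qed.

Lemma zero_in_time : (0 : R) \in time r.
Proof. by rewrite inE /time /= in_itv/= oppr_le0 !ltW. Qed.

Definition time0 : time r := Sub 0 zero_in_time.

(** Outside the time interval the value is that at time 0, so inequalities between curves lift to
    all [t]. *)
Definition lift (z : time r -> R) (t : R) : R := z (insubd time0 t).

Lemma lift_val z (y : time r) : lift z (val y) = z y.
Proof. by rewrite /lift valKd. Qed.

Lemma lift_restrict (w : R -> R) t : time r t -> lift (w \o val) t = w t.
Proof. by move=> Dt; rewrite /lift /= insubdK// inE. Qed.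

Lemma timeP t : time r t -> exists y : time r, val y = t.
Proof. by move=> Dt; exists (insubd time0 t); rewrite insubdK// inE. Qed.

Lemma time_norm t : time r t -> `|t| <= delta.
Proof. by rewrite /time /= in_itv/= ler_norml. Qed.

Lemma time_interval : is_interval (time r).
Proof. exact: interval_is_interval. Qed.

(** A priori bound: up to a first exit time [u] the curve is in the square, where slopes are at most
    [L < 1], so [|z u| <= delta + L * delta < r], a contradiction. *)
Lemma is_solution_norm_lt z (y : time r) : is_solution Omega psi z -> `|z y| < r.
Proof.
move=> [_ dz z0]; have L0 := field_bound_ge0; have d0 := delta_gt0.
have dw t : time r t -> deriv_within (time r) (lift z) t (psi (t, lift z t)).
  move=> /timeP[u <-]; rewrite lift_val; have [_] := dz u.
  by apply: (has_derivP _ _ _ _ _).1 => v; rewrite lift_val.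
have w0 : `|lift z 0| <= delta.
  by rewrite ler_norml -[0]/(val time0) lift_val; exact: z0.
rewrite ltNge; apply/negP => zy.
pose A : set R := [set t | time r t /\ r <= `|lift z t|].
have cA : compact A.
  apply: (@subclosed_compact _ _ (time r)); [|exact: segment_compact|by move=> t []].
  move=> p clp; have Dp : time r p.
    by apply: (@interval_closed R (BLeft (- delta)) (BRight delta)) => // B /clp[t [[Dt _] Bt]]; exists t.
  split=> //; rewrite leNgt; apply/negP => wp.
  have e0 : 0 < r - `|lift z p| by rewrite subr_gt0.
  have /cvgrPdist_lt/(_ _ e0) := deriv_within_continuous _ _ _ _ (dw p Dp).
  rewrite near_withinE => /clp[t [[Dt rt] /(_ Dt)]].
  have := ler_distD (lift z p) (lift z t) 0; rewrite !subr0 (distrC (lift z t)).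
  lra.
(* Minimizing [|t|] finds the exit time closest to 0, forward or backward. *)
have [||u uA umin] := @compact_EVT_min _ _ (fun t : R => `|t|) A _ cA.
- by exists (val y); split; [exact: set_valP|rewrite lift_val].
- by apply: continuous_subspaceT => t; exact: norm_continuous.
move: uA; rewrite inE => -[Du ru].
have lt_r c : time r c -> `|c| < `|u| -> `|lift z c| < r.
  move=> Dc cu; rewrite ltNge; apply/negP => rc.
  by have := umin c; rewrite inE leNgt cu => /(_ (conj Dc rc)).
have slope c : time r c -> `|c| < `|u| -> `|psi (c, lift z c)| <= L.
  move=> Dc cu; rewrite -field_id ?field_norm_le// ?(ltW (lt_r c Dc cu))//.
  by apply: le_trans (time_norm _ Dc) _; have := r_gt0; lra.
have D0 : time r 0 by have := zero_in_time; rewrite inE.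
have diff_le : `|lift z u - lift z 0| <= L * `|u|.
  have [u0|u0|->] := ltgtP u 0; last by rewrite !subrr normr0 mulr0.
  - have [|c /andP[uc c0] h] := @mean_value _ (lift z) (fun t => psi (t, lift z t)) u 0 u0.
      move=> v uv; apply: (deriv_withinS (time r)); last first.
        by apply: dw; exact: time_interval Du D0 _ uv.
      by move=> x; rewrite /= in_itv/=; exact: time_interval Du D0 x.
    rewrite distrC h normrM sub0r normrN ler_wpM2r//; apply: slope.
      by apply: (time_interval _ _ Du D0); rewrite !ltW.
    by rewrite !ltr0_norm// ltrN2.
  - have [|c /andP[c0 cu] ->] := @mean_value _ (lift z) (fun t => psi (t, lift z t)) 0 u u0.
      move=> v uv; apply: (deriv_withinS (time r)); last first.
        by apply: dw; exact: time_interval D0 Du _ uv.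
      by move=> x; rewrite /= in_itv/=; exact: time_interval D0 Du x.
    rewrite normrM subr0 ler_wpM2r//; apply: slope.
      by apply: (time_interval _ _ D0 Du); rewrite !ltW.
    by rewrite !gtr0_norm.
have := ler_distD (lift z 0) (lift z u) 0; rewrite !subr0.
have : L * `|u| <= L * delta by rewrite ler_wpM2l// time_norm.
have : L * delta < 1 * delta by rewrite ltr_pM2r.
lra.
Qed.

(** Solutions of either equation stay in the square, where [field] and [psi] agree. The C1 clause
    comes for free, the derivative being [field] along the curve. *)
Lemma is_solutionP z : is_solution Omega psi z <->
  ode_within (time r) field (lift z) /\ `|lift z 0| <= delta.
Proof.
have lz (v : time r) : z v = lift z (val v) by rewrite lift_val.
have time_r t : time r t -> `|t| <= r.
  by move=> /time_norm /le_trans; apply; have := r_gt0; lra.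
split=> [solz|[oz z0]].
  have zr := fun y => ltW (is_solution_norm_lt z y solz).
  have [_ dz z0] := solz; split; last first.
    by rewrite ler_norml -[0]/(val time0) lift_val; exact: z0.
  move=> t /[dup] Dt /timeP[u ut]; rewrite -ut in Dt *.
  rewrite field_id ?lift_val ?zr ?time_r//; have [_] := dz u.
  exact: (has_derivP _ _ _ _ lz).1.
have zr t : time r t -> `|lift z t| <= r.
  move=> Dt; have D0 : time r 0 by have := zero_in_time; rewrite inE.
  have az := ode_within_approx _ _ L 0 _ time_interval (lexx _) oz.
  have := approx_within_lipschitz _ _ _ _ _ field_bound_ge0 field_norm_le az 0 t D0 Dt.
  rewrite subr0 addr0 => h.
  have := ler_distD (lift z 0) (lift z t) 0; rewrite !subr0.
  have : L * `|t| <= 1 * delta.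
    by rewrite ler_pM ?field_bound_ge0 ?time_norm// ltW.
  lra.
have dz (y : time r) : has_deriv z y (field (val y) (z y)).
  by apply/(has_derivP _ (lift z)) => //; rewrite -(lift_val z); exact/oz/set_valP.
split.
- exists (fun y => field (val y) (z y)) => // y.
  apply/(@cvgrPdist_le _ _ _ _ (@nbhs_filter (time r) y)) => e e0.
  have [rho rho0 hrho] := field_continuous (val y) (z y) e e0.
  have /cvgrPdist_lt/(_ _ rho0) := @deriv_within_continuous _ _ _ _ _ (oz _ (set_valP y)).
  rewrite near_withinE lift_val => /nbhs_ballP[rho' rho'0 hrho'].
  apply/nbhs_ballP; exists (Num.min rho rho'); first by rewrite /= lt_min rho0.
  move=> u uy; have : `|val y - val u| < Num.min rho rho' by exact: uy.
  rewrite lt_min => /andP[h1 h2].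
  rewrite distrC; apply: hrho; first by rewrite distrC.
  by rewrite distrC -(lift_val z u); apply: hrho' (h2) (set_valP u).
- move=> y; have Dy := set_valP y; split; last first.
    by rewrite -field_id; [exact: dz|exact: time_r|rewrite lz; exact: zr].
  apply: square_sub; split; rewrite /= in_itv/= -ler_norml; first exact: time_r.
  by rewrite -lift_val; exact: zr.
- by move=> y y0; rewrite -ler_norml -lift_val y0.
Qed.

Local Notation sol := (solution r Omega psi).
Implicit Types s : sol.

Lemma sol_ode s : ode_within (time r) field (lift s).
Proof. by have /asboolP/is_solutionP[] := curveP s. Qed.

Lemma sol0 s : `|lift s 0| <= delta.
Proof. by have /asboolP/is_solutionP[] := curveP s. Qed.

Lemma sol_norm_le s y : `|s y| <= r.
Proof. by apply/ltW/is_solution_norm_lt/asboolP; exact: curveP. Qed.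

Lemma solution_of_ode (w : R -> R) : ode_within (time r) field w -> `|w 0| <= delta ->
  exists s : sol, forall y, s y = w (val y).
Proof.
move=> ow w0; have D0 : time r 0 by have := zero_in_time; rewrite inE.
suff solw : `[< is_solution Omega psi (w \o val : time r -> R) >].
  by exists (Solution solw).
apply/asboolP/is_solutionP; rewrite lift_restrict//; split=> //.
by apply: ode_within_eq ow => t Dt; rewrite lift_restrict.
Qed.

Lemma sol_dist_le s t u : time r t -> time r u ->
  `|lift s t - lift s u| <= `|t - u|.
Proof.
move=> Dt Du.
have az := ode_within_approx _ _ L 0 _ time_interval (lexx _) (sol_ode s).
have := approx_within_lipschitz _ _ _ _ _ field_bound_ge0 field_norm_le az u t Du Dt.
by rewrite addr0 => /le_trans; apply; rewrite ler_piMl// ltW.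
Qed.

Lemma sol_continuous s : {within `[- delta, delta], continuous (lift s)}.
Proof.
apply/subspace_continuousP => t Dt.
exact: deriv_within_continuous (sol_ode s t Dt).
Qed.

(** * The integral as a coordinate on chains of solutions *)

Definition area s : R := \int[lebesgue_measure]_(t in `[- delta, delta]) lift s t.

Let delta_lt : - delta < delta. Proof. by rewrite gtrN. Qed.

Let delta_width : delta - - delta = r. Proof. by field. Qed.

Lemma sol_le s1 s2 y : s1 <= s2 -> s1 y <= s2 y.
Proof. by move/solution_leP; exact. Qed.

Lemma lift_le s1 s2 t : s1 <= s2 -> lift s1 t <= lift s2 t.
Proof. exact: sol_le. Qed.

Lemma sol_dist_u s1 s2 y : `|s1 y - s2 y| <= d_u s1 s2.
Proof.
apply: ub_le_sup; last by exists y.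
exists (2 * r) => _ [u _ <-]; apply: le_trans (ler_normB _ _) _.
by rewrite mulr_natl mulr2n lerD ?sol_norm_le.
Qed.

Lemma area_dist_le s1 s2 e : (forall y, `|s1 y - s2 y| <= e) ->
  `|area s1 - area s2| <= e * r.
Proof.
move=> h; rewrite -delta_width; apply: Rintegral_dist_le => //;
  by [exact: sol_continuous|move=> t _; exact: h].
Qed.

Lemma le_area s1 s2 : s1 <= s2 -> area s1 <= area s2.
Proof.
move=> s12; apply: le_Rintegral => //; try exact/continuous_segment_integrable/sol_continuous.
by move=> t _; exact: lift_le.
Qed.

(* The difference of two solutions is 2-Lipschitz, so its integral controls its
   maximum: this makes the inverse of [area] uniformly continuous on chains. *)
Lemma area_gap (d : R) : 0 < d -> exists2 eta : R, 0 < eta & forall s1 s2, s1 <= s2 ->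
  area s2 - area s1 < eta -> forall y, s2 y - s1 y < d.
Proof.
(* The bound of [Rintegral_ge_peak] for a segment of length [r] and Lipschitz constant 2. *)
move=> d0; exists (d / 2 * Num.min (r / 2) (d / (2 * 2))).
  by rewrite mulr_gt0 ?divr_gt0// lt_min !divr_gt0// mulr_gt0.
move=> s1 s2 s12 a12 y; rewrite ltNge; apply/negP => dy.
have Dy := set_valP y.
have tD t : - delta <= t <= delta -> time r t by rewrite /time /= in_itv.
move: a12; rewrite ltNge => /negP; apply.
have i1 := continuous_segment_integrable _ _ _ (sol_continuous s1).
have i2 := continuous_segment_integrable _ _ _ (sol_continuous s2).
rewrite /area -RintegralB// -{1}delta_width.
apply: (@Rintegral_ge_peak _ (- delta) delta delta_lt _ d 2 (val y)) => //.
- by move=> t; exact: continuousB (sol_continuous s2 t) (sol_continuous s1 t).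
- by move=> t _; rewrite subr_ge0 lift_le.
- move=> t /tD Dt.
  have := sol_dist_le s1 t (val y) Dt Dy; have := sol_dist_le s2 t (val y) Dt Dy.
  by rewrite !ler_norml; lra.
- by rewrite !lift_val.
Qed.

Lemma area_modulus (d : R) : 0 < d -> exists2 eta : R, 0 < eta & forall s1 s2,
  s1 >=< s2 -> `|area s1 - area s2| < eta -> forall y, `|s1 y - s2 y| < d.
Proof.
move=> /area_gap[eta eta0 gap]; exists eta => // s1 s2 /orP[s12|s21] a12 y.
  rewrite distrC ger0_norm ?subr_ge0; last exact: sol_le.
  by apply: gap => //; rewrite distrC in a12; exact: le_lt_trans (ler_norm _) a12.
rewrite ger0_norm ?subr_ge0; last exact: sol_le.
by apply: gap => //; exact: le_lt_trans (ler_norm _) a12.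
Qed.

Lemma area_inj s1 s2 : s1 >=< s2 -> area s1 = area s2 -> s1 = s2.
Proof.
move=> c12 a12; apply/val_inj/funext => y; apply/eqP; rewrite -subr_eq0 -normr_le0.
apply/ler_addgt0Pl => d d0; rewrite addr0; have [eta eta0 h] := area_modulus d d0.
by apply/ltW/h => //; rewrite a12 subrr normr0.
Qed.

Lemma area_le s1 s2 : s1 >=< s2 -> (area s1 <= area s2) = (s1 <= s2).
Proof.
move=> c12; apply/idP/idP; last exact: le_area.
move=> a12; case/orP: (c12) => // s21; rewrite (area_inj _ _ c12)//.
by apply/le_anti; rewrite a12 le_area.
Qed.

(** * Existence of further solutions comparable with given ones *)

Lemma sol_peano t0 c : exists2 w : R -> R, w t0 = c & ode_within (time r) field w.
Proof.
have [w w0 ow] := @peano _ field L t0 c field_bound_ge0 field_norm_le field_continuous.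
by exists w => // s Ds; apply: (deriv_withinS setT) => //; exact: ow.
Qed.

Lemma sol_dense s1 s2 : s1 < s2 -> exists2 s, s1 < s & s < s2.
Proof.
move=> /[dup] lt12 /ltW s12.
have [y y12] : exists y, s1 y < s2 y.
  apply: contrapT => /forallNP le21; suff : s2 <= s1 by rewrite lt_geF.
  by apply/solution_leP => y; rewrite leNgt; apply/negP/le21.
have [w wy ow] := sol_peano (val y) ((s1 y + s2 y) / 2).
pose z t := Num.max (lift s1 t) (Num.min (lift s2 t) (w t)).
have oz : ode_within (time r) field z.
  apply: ode_within_max; first exact: sol_ode.
  by apply: ode_within_min => //; exact: sol_ode.
have zge t : lift s1 t <= z t by rewrite le_max lexx.
have zle t : z t <= lift s2 t by rewrite ge_max ge_min lexx lift_le.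
have z0 : `|z 0| <= delta.
  have := sol0 s1; have := sol0 s2; rewrite !ler_norml => /andP[_ h2] /andP[h1 _].
  by rewrite (le_trans h1 (zge 0)) (le_trans (zle 0) h2).
have [s sz] := solution_of_ode z oz z0.
(* At [y] the clipping is inactive: the midpoint value separates [s] from both [s1] and [s2]. *)
have sy : s y = (s1 y + s2 y) / 2.
  rewrite sz /z !lift_val wy min_r; last by lra.
  by rewrite max_r//; lra.
have s1s : s1 <= s by apply/solution_leP => u; rewrite sz -(lift_val s1).
have ss2 : s <= s2 by apply/solution_leP => u; rewrite sz -(lift_val s2).
exists s; rewrite lt_neqAle ?s1s ?ss2 andbT; apply/eqP.
  by move=> e; move: sy; rewrite -e; lra.
by move=> e; move: sy; rewrite e; lra.
Qed.

(** If [s] starts below [delta], take its maximum with a solution through [delta] at time 0;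
    otherwise its minimum with one through [- delta]. *)
Lemma sol_not_isolated s : exists2 s' : sol, s' != s & s >=< s'.
Proof.
have d0 := delta_gt0.
have nd c : c = delta \/ c = - delta -> `|c| <= delta.
  by case=> ->; rewrite ?normrN gtr0_norm.
have [lt0|ge0] := ltP (lift s 0) delta.
  have [w w0 ow] := sol_peano 0 delta.
  have om := ode_within_max _ _ _ _ (sol_ode s) ow.
  have m0 : Num.max (lift s 0) (w 0) = delta by rewrite w0 max_r// ltW.
  have [|s' s'E] := solution_of_ode _ om; first by rewrite m0; apply: nd; left.
  exists s'; first apply/eqP => e.
    have := etrans (lift_val s' time0) (etrans (s'E time0) m0).
    by rewrite /= e => e0; move: lt0; rewrite e0 ltxx.
  by apply/orP; left; apply/solution_leP => y; rewrite s'E le_max lift_val lexx.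
have [w w0 ow] := sol_peano 0 (- delta).
have om := ode_within_min _ _ _ _ (sol_ode s) ow.
have m0 : Num.min (lift s 0) (w 0) = - delta by rewrite w0 min_r//; lra.
have [|s' s'E] := solution_of_ode _ om; first by rewrite m0; apply: nd; right.
exists s'; first apply/eqP => e.
  have := etrans (lift_val s' time0) (etrans (s'E time0) m0).
  by rewrite /= e; lra.
by apply/orP; right; apply/solution_leP => y; rewrite s'E ge_min lift_val lexx.
Qed.

Lemma sol_inhabited : inhabited sol.
Proof.
have [w w0 ow] := sol_peano 0 0.
by have [|s _] := solution_of_ode w ow; [rewrite w0 normr0 ltW|].
Qed.

(** * Maximal chains *)

Section Chain.
Variable T : set sol.
Hypothesis flowT : local_flow T.

Lemma flow_comparable s1 s2 : T s1 -> T s2 -> s1 >=< s2.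
Proof. by move=> T1 T2; apply/orP; exact: (flowT.1). Qed.

(** Adding [s] to [T] keeps it a chain, which maximality forces to be [T] itself. *)
Lemma flow_maximal s : (forall s', T s' -> s >=< s') -> T s.
Proof.
move=> cs; rewrite -(flowT.2 (T `|` [set s])); [by right| |by move=> s' Ts'; left].
move=> s1 s2 [T1|->] [T2|->]; apply/orP.
- exact: flow_comparable.
- by rewrite orbC; exact: cs.
- exact: cs.
- by rewrite lexx.
Qed.

Lemma flow_neq0 : T !=set0.
Proof.
apply/set0P/eqP => T0; have [s] := sol_inhabited.
suff : T s by rewrite T0.
by apply: flow_maximal => s'; rewrite T0.
Qed.

Lemma flow_nontrivial s : T s -> exists2 s', T s' & s' != s.
Proof.
move=> Ts; apply: contrapT => /forall2NP T1; have [s' s's cs] := sol_not_isolated s.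
have [/(_ _)|/(_ s's)//] := T1 s'; apply; apply: flow_maximal => s'' Ts''.
have [//|/negP/negPn/eqP ->] := T1 s''.
by rewrite comparable_sym.
Qed.

(** [approx_within_limit] makes the uniform limit a solution. It is comparable with each [s'] in
    [T]: if it exceeds [s'] somewhere, so do close approximants, which then lie above [s']
    everywhere. *)
Lemma flow_closed (S : time r -> R) :
    (forall e, 0 < e -> exists2 s, T s & forall y, `|s y - S y| <= e) ->
  exists2 s, T s & forall y, s y = S y.
Proof.
move=> approxS.
have oS : ode_within (time r) field (lift S).
  apply: (@approx_within_limit _ _ _ L _ field_bound_ge0 field_norm_le field_continuous).
  move=> e t u e0 Dt Du; have [s Ts sS] := approxS e e0.
  exists (lift s); split; try exact: sS.
  by apply: ode_within_approx; [exact: time_interval|exact: ltW|exact: sol_ode].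
have S0 : `|lift S 0| <= delta.
  apply/ler_addgt0Pr => e e0; have [s Ts sS] := approxS e e0.
  rewrite -(subrK (lift s 0) (lift S 0)) addrC (le_trans (ler_normD _ _))//.
  by rewrite lerD ?sol0// distrC; exact: sS.
have [s sE] := solution_of_ode _ oS S0.
have {}sE y : s y = S y by rewrite sE lift_val.
exists s => //; apply: flow_maximal => s' Ts'; apply/orP.
have [|/existsNP[y /negP]] := pselect (forall y, s y <= s' y).
  by move=> /solution_leP; left.
rewrite -ltNge => s'y; right; apply/solution_leP => u; apply/ler_addgt0Pr => e e0.
(* Half of the excess at [y] rules out [x <= s']; the bound [e] transfers the comparison at [u]. *)
have m0 : 0 < Num.min e ((s y - s' y) / 2) by rewrite lt_min e0 divr_gt0// subr_gt0.
have [x Tx xS] := approxS _ m0.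
have : s' <= x.
  case/orP: (flow_comparable _ _ Ts' Tx) => // /solution_leP /(_ y) xs'.
  by exfalso; have := xS y; rewrite le_min -sE !ler_norml; lra.
move=> /solution_leP /(_ u).
by have := xS u; rewrite le_min -sE !ler_norml; lra.
Qed.

(** Members of [T] whose integrals converge form a uniformly Cauchy sequence by [area_modulus]; the
    limit is in [T] by [flow_closed] and has the limiting integral. *)
Lemma area_flow_closed : closed (area @` T).
Proof.
move=> x clx.
have near_x e : 0 < e -> exists2 s, T s & `|area s - x| < e.
  move=> e0; have [|_ [[s Ts <-] sx]] := clx (ball x e); first exact: nbhsx_ballx.
  by exists s => //; rewrite distrC.
have [s_ Ts_ s_x] : exists2 s_ : nat -> sol, (forall n, T (s_ n)) &
    forall n, `|area (s_ n) - x| < harmonic n.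
  have H n : exists s, T s /\ `|area s - x| < harmonic n.
    by have [|s] := near_x (harmonic n); [exact: harmonic_gt0|exists s].
  have [s_ Hs] := choice H.
  by exists s_ => n; have [] := Hs n.
have small e : 0 < e -> exists N, forall n, (N <= n)%N -> `|area (s_ n) - x| < e.
  move=> e0; have /cvgrPdist_lt/(_ _ e0)[N _ hN] := @cvg_harmonic R.
  exists N => n /hN; rewrite sub0r normrN => hn.
  exact: lt_trans (s_x n) (le_lt_trans (ler_norm _) hn).
have unif d : 0 < d -> exists N : nat, forall n m y, (N <= n)%N -> (N <= m)%N ->
    `|s_ n y - s_ m y| < d.
  move=> d0; have [eta eta0 heta] := area_modulus d d0.
  have e0 : 0 < eta / 2 by rewrite divr_gt0.
  have [N hN] := small _ e0.
  exists N => n m y Nn Nm; apply: heta; first exact: flow_comparable.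
  by have := hN n Nn; have := hN m Nm; rewrite !ltr_norml; lra.
pose S y : R := lim (s_ n y @[n --> \oo]).
have S_cvg y : s_ n y @[n --> \oo] --> S y.
  apply: cauchy_cvg; apply: cauchy_exP => e e0; have [N hN] := unif e e0.
  by exists (s_ N y); exists N => // n /= Nn; exact: hN.
have S_unif d : 0 < d -> exists N : nat, forall n y, (N <= n)%N -> `|s_ n y - S y| <= d.
  move=> d0; have [N hN] := unif d d0; exists N => n y Nn.
  apply/ler_addgt0Pr => e e0.
  have /cvgrPdist_le/(_ _ e0)[M _ hM] := S_cvg y.
  have := hM (maxn N M) (leq_maxr _ _); have := hN n (maxn N M) y Nn (leq_maxl _ _).
  rewrite distrC => /ltW h1 h2.
  apply: le_trans (ler_distD (s_ (maxn N M) y) _ _) _.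
  by rewrite lerD// distrC.
have [s Ts sS] : exists2 s, T s & forall y, s y = S y.
  apply: flow_closed => e e0; have [N hN] := S_unif e e0.
  by exists (s_ N) => // y; exact: hN.
exists s => //; apply/eqP; rewrite -subr_eq0 -normr_le0.
apply/ler_addgt0Pl => e e0; rewrite addr0.
(* Division by [r] offsets the factor of [area_dist_le]; the other half of [e] pays for the
   convergence of the integrals. *)
have d0 : 0 < e / 2 / r by rewrite !divr_gt0.
have [N hN] := S_unif _ d0.
have e20 : 0 < e / 2 by rewrite divr_gt0.
have [M hM] := small _ e20.
have := hM (maxn N M) (leq_maxr _ _).
have := area_dist_le s (s_ (maxn N M)) (e / 2 / r).
rewrite divfK ?gt_eqF// => /(_ _)/wrap[y|]; first by rewrite sS distrC hN// leq_maxl.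
by rewrite !ler_norml ltr_norml; lra.
Qed.

Lemma area_flow_interval : exists a b : R, [/\ a < b,
  forall s, T s -> a <= area s <= b &
  forall x, a <= x <= b -> exists2 s, T s & area s = x].
Proof.
have [s0 Ts0] := flow_neq0; pose K := area @` T.
have K0 : K !=set0 by exists (area s0), s0.
have bound s : `|area s - area s0| <= 2 * r * r.
  apply: area_dist_le => y; apply: le_trans (ler_normB _ _) _.
  by rewrite mulr_natl mulr2n lerD ?sol_norm_le.
have ubK : has_ubound K.
  by exists (area s0 + 2 * r * r) => _ [s _ <-]; have := bound s; rewrite ler_distl => /andP[].
have lbK : has_lbound K.
  by exists (area s0 - 2 * r * r) => _ [s _ <-]; have := bound s; rewrite ler_distl => /andP[].
have [] := closed_dense_interval K K0 ubK lbK area_flow_closed.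
  move=> _ _ [s1 T1 <-] [s2 T2 <-] a12.
  have c12 := flow_comparable _ _ T1 T2.
  have lt12 : s1 < s2.
    rewrite lt_neqAle -area_le// (ltW a12) andbT.
    by apply: contraTneq a12 => ->; rewrite ltxx.
  have [s s1s ss2] := sol_dense _ _ lt12.
  have lt_area (u v : sol) : u < v -> area u < area v.
    move=> /[dup] uv /ltW uv'; rewrite lt_neqAle le_area// andbT.
    apply/eqP => /area_inj uvE; move: uv; rewrite uvE ?ltxx//.
    by rewrite /Order.comparable uv'.
  (* Without a member of [T] whose integral lies strictly between, [s] would be comparable with all
     of [T], hence belong to [T], and its own integral gives a contradiction. *)
  apply: contrapT => noK.
  have gap s' : T s' -> ~~ (area s1 < area s' < area s2).
    by move=> Ts'; apply/negP => s'12; apply: noK; exists (area s') => //; exists s'.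
  have Ts : T s.
    apply: flow_maximal => s' Ts'; apply/orP.
    have := gap s' Ts'; rewrite negb_and -!leNgt => /orP[].
      rewrite area_le; last exact: flow_comparable.
      by move=> s's1; right; exact: le_trans s's1 (ltW s1s).
    rewrite area_le; last exact: flow_comparable.
    by move=> s2s'; left; exact: le_trans (ltW ss2) s2s'.
  by have := gap s Ts; rewrite !lt_area.
move=> Kinf Ksup Kint.
exists (inf K), (sup K); split.
(* If [inf K = sup K], then [s] and [s0] have equal integrals and coincide by [area_inj]. *)
- have [s Ts ss0] := flow_nontrivial s0 Ts0.
  have inK u : T u -> inf K <= area u <= sup K.
    by move=> Tu; rewrite ge_inf ?ub_le_sup//; exists u.
  have /andP[i0 u0] := inK _ Ts0; have /andP[i1 u1] := inK _ Ts.
  rewrite lt_neqAle (le_trans i0 u0) andbT; apply: contra ss0 => /eqP eis.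
  apply/eqP/area_inj; first exact: flow_comparable.
  by apply/le_anti; rewrite (le_trans u1)/= -?eis//= (le_trans u0)// -eis.
- by move=> s Ts; rewrite ge_inf ?ub_le_sup//; exists s.
- by move=> x /Kint[s Ts <-]; exists s.
Qed.

End Chain.

End Field.

(** * The order-preserving homeomorphism *)

Theorem mainTheorem3 (R : realType) (r : R) (r_gt0 : 0 < r)
    (Omega : set (R * R)) (openOmega : open Omega)
    (square_sub : `[- r, r] `*` `[- r, r] `<=` Omega)
    (psi : R * R -> R) (psi_cont : {within Omega, continuous psi})
    (psi_lt1 : sup [set `|psi p| | p in `[- r, r] `*` `[- r, r]] < 1)
    (T : set (solution r Omega psi)) (flowT : local_flow T) :
  exists (h : T -> unit_interval R) (k : unit_interval R -> T),
    [/\ cancel h k, cancel k h, continuous h, continuous k &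
        forall z1 z2 : T,
          ((val z1 : solution r Omega psi) <= val z2) =
          ((val (h z1) : R) <= val (h z2))].
Proof.
pose A := @area R r Omega psi r_gt0.
have [a [b [ab A_in A_onto]]] : exists a b : R, [/\ a < b,
    forall s, T s -> a <= A s <= b &
    forall x, a <= x <= b -> exists2 s, T s & A s = x].
  exact: area_flow_interval.
have A_dist (s1 s2 : solution r Omega psi) e : (forall y, `|s1 y - s2 y| <= e) -> `|A s1 - A s2| <= e * r.
  exact: area_dist_le.
have A_mod d : 0 < d -> exists2 eta : R, 0 < eta & forall s1 s2 : solution r Omega psi,
    s1 >=< s2 -> `|A s1 - A s2| < eta -> forall y, `|s1 y - s2 y| < d.
  exact: area_modulus.
have A_inj (s1 s2 : solution r Omega psi) : s1 >=< s2 -> A s1 = A s2 -> s1 = s2 by exact: area_inj.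
have A_le (s1 s2 : solution r Omega psi) : s1 >=< s2 -> (A s1 <= A s2) = (s1 <= s2) by exact: area_le.
have dist_u (s1 s2 : solution r Omega psi) y : `|s1 y - s2 y| <= d_u s1 s2.
  exact: sol_dist_u.
have T_cmp (z1 z2 : T) : val z1 >=< val z2.
  exact: flow_comparable flowT _ _ (set_valP z1) (set_valP z2).
have ba0 : 0 < b - a by rewrite subr_gt0.
have h_in (z : T) : (A (val z) - a) / (b - a) \in unit_interval R.
  have /andP[az zb] := A_in _ (set_valP z).
  by rewrite inE /unit_interval/= in_itv/= divr_ge0 ?ler_pdivrMr ?mul1r ?lerB// subr_ge0// ltW.
(* The integral, rescaled affinely from its range between [a] and [b] to the unit interval. *)
pose h (z : T) : unit_interval R := exist (fun x => x \in unit_interval R) _ (h_in z).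
have hE (z : T) : val (h z) = (A (val z) - a) / (b - a) by [].
have [k kE] : exists k : unit_interval R -> T,
    forall x, A (val (k x)) = a + val x * (b - a).
  suff H (x : unit_interval R) : exists z : T, A (val z) = a + val x * (b - a).
    by have [k kE] := choice H; exists k.
  have := set_valP x; rewrite /unit_interval/= in_itv/= => /andP[x0 x1].
  have [|s Ts sx] := A_onto (a + val x * (b - a)).
    rewrite lerDl mulr_ge0 ?(ltW ba0)//= -lerBrDl.
    by rewrite ler_piMl// ltW.
  have sT : s \in T by rewrite inE.
  by exists (exist (fun s => s \in T) s sT).
exists h, k; split.
- move=> z; apply/val_inj/A_inj; first exact: T_cmp.
  by rewrite kE hE divfK ?gt_eqF// subrKC.
- by move=> x; apply/val_inj; rewrite hE kE addrC addKr mulfK// gt_eqF.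
- apply: continuous_subset_ball => z e e0.
  exists (e * (b - a) / r) => [|z' zz']; first by rewrite divr_gt0// mulr_gt0.
  have du : d_u (val z) (val z') < e * (b - a) / r by exact: zz'.
  change (`|val (h z) - val (h z')| < e); rewrite !hE -mulrBl opprB addrA subrK normrM normfV (gtr0_norm ba0).
  rewrite ltr_pdivrMr//; apply: le_lt_trans (A_dist _ _ _ (dist_u _ _)) _.
  by rewrite -ltr_pdivlMr.
- apply: continuous_subset_ball => x e e0.
  (* Pointwise strict bounds only give a weak one for the supremum; starting from [e / 2] restores
     strictness. *)
  have [|eta eta0 heta] := A_mod (e / 2); first by rewrite divr_gt0.
  exists (eta / (b - a)) => [|y xy]; first by rewrite divr_gt0.
  change (d_u (val (k x)) (val (k y)) < e).
  apply: (@le_lt_trans _ _ (e / 2)); last by rewrite ltr_pdivrMr// ltr_pMr// ltr1n.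
  pose t0 := time0 r r_gt0.
  (* The set under the supremum must be nonempty; time 0 provides an element. *)
  apply: ge_sup; first by exists `|val (k x) t0 - val (k y) t0|, t0.
  move=> _ [t _ <-]; apply/ltW/heta; first exact: T_cmp.
  rewrite !kE opprD addrACA subrr add0r -mulrBl normrM (gtr0_norm ba0).
  by rewrite -ltr_pdivlMr.
- move=> z1 z2; rewrite !hE ler_pM2r ?invr_gt0// lerD2r A_le//; exact: T_cmp.
Qed.
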